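(* Let $W$ be a discrete memoryless channel with finite input alphabet $\mathcal{X}$ and finite output alphabet $\mathcal{Y}$, let $R$ be a rate, $P$ a probability distribution on $\mathcal{X}$, and $\rho\ge 1$. Let $V=(V(x'|x))_{x,x'\in\mathcal{X}}$ be an $|\mathcal{X}|\times|\mathcal{X}|$ stochastic matrix (so $V(\cdot|x)$ is a probability distribution on $\mathcal{X}$ for each $x$) such that $PV=P$, i.e. $\sum_{x}P(x)V(x'|x)=P(x')$ for all $x'\in\mathcal{X}$. If $$R> I(P,V)+\vartheta(\rho,P,V),$$ then $$d(R,P)\le \rho\,\vartheta(\rho,P,V).$$
   Context: All logarithms are natural, $\log(1/0)=+\infty$, $-\log 0=+\infty$, and $0\cdot\infty=0$. Channel and state vectors. $W(y|x)$, $x\in\mathcal{X}$, $y\in\mathcal{Y}$, are the transition probabilities. For $x\in\mathcal{X}$, $\psi_x$ is the unit vector in $\mathbb{R}^{\mathcal{Y}}$ with components $\psi_x(y)=\sqrt{W(y|x)}$. For $\bm{x}=(x_1,\dots,x_n)\in\mathcal{X}^n$, $\bm{\psi}_{\bm{x}}=\psi_{x_1}\otimes\cdots\otimes\psi_{x_n}$; so $\bm{\psi}_{\bm{x}}^\dagger\bm{\psi}_{\bm{x}'}=\prod_{i=1}^n\psi_{x_i}^\dagger\psi_{x_i'}\ge 0$. The channel may have a positive zero-error capacity, i.e. some of the products $\psi_x^\dagger\psi_{x'}$ may be $0$. Representations. For $\rho\ge1$, $\Gamma(\rho)$ is the set of all families $\{\tilde\psi_x\}_{x\in\mathcal{X}}$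 of unit norm vectors in any Hilbert space such that $|\tilde\psi_x^\dagger\tilde\psi_{x'}|\le(\psi_x^\dagger\psi_{x'})^{1/\rho}$ for all $x,x'\in\mathcal{X}$. The function $\vartheta$. For a probability distribution $Q$ on $\mathcal{X}$, $$\vartheta(\rho,Q)=\min_{\{\tilde\psi_x\}\in\Gamma(\rho),\,f}\ \sum_{x\in\mathcal{X}}Q(x)\log\frac{1}{|\tilde\psi_x^\dagger f|^2},$$ where $f$ ranges over unit norm vectors of the Hilbert space containing the $\tilde\psi_x$. For a distribution $P$ and a stochastic matrix $V$, $$\vartheta(\rho,P,V)=\sum_{x\in\mathcal{X}}P(x)\,\vartheta(\rho,V(\cdot|x)).$$ Mutual information. $I(P,V)=\sum_{x,x'}P(x)V(x'|x)\log\dfrac{V(x'|x)}{(PV)(x')}$, where $(PV)(x')=\sum_xP(x)V(x'|x)$. Codes and asymptotic minimum distance. A code of length $n$ with $M$ codewords is a collection $\mathcal{C}=\{\bm{x}_1,\dots,\bm{x}_M\}\subseteq\mathcal{X}^n$; its rate is $\frac1n\log M$. The composition of a sequence $\bm{x}\in\mathcal{X}^n$ is the distribution on $\mathcal{X}$ giving each symbol its relative frequency in $\bm{x}$. A code has constant composition if all its codewords have the same composition. The asymptotic minimum distance is $$d(R,P)=\limsup_{n\to\infty}\ \max_{\mathcal{C}}\left[-\frac1n\log\max_{m\ne m'}\bm{\psi}_{\bm{x}_m}^\dagger\bm{\psi}_{\bm{x}_{m'}}\right],$$ where the maximum is over all (constant composition) codes of length $n$, rate at least $R$, and compositions tending to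 $P$ as $n\to\infty$. That is, $d(R,P)$ is the supremum, over all sequences of constant composition codes whose block-lengths $n$ tend to infinity, whose rates are all at least $R$, and whose compositions $P_n$ converge to $P$, of the $\limsup$ of the bracketed quantity. *)

(* Defs.v *)
From HB Require Import structures.
From mathcomp Require Import all_boot all_order all_algebra.
From mathcomp Require Import all_classical all_reals all_analysis.
From mathcomp Require Import complex.

Set Implicit Arguments.
Unset Strict Implicit.
Unset Printing Implicit Defensive.

Import Order.TTheory GRing.Theory Num.Theory.
Import numFieldNormedType.Exports.
Import ComplexField.

Local Open Scope classical_set_scope.
Local Open Scope ring_scope.
Local Open Scope complex_scope.

Definition is_dist (R : realType) (T : finType) (Q : T -> R) : Prop :=
  (forall t, 0 <= Q t) /\ \sum_t Q t = 1.

(* [A x y] is the probability A(y|x). *)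
Definition is_stochastic (R : realType) (S T : finType) (A : S -> T -> R) :
    Prop :=
  forall x, is_dist (A x).

Definition out_dist (R : realType) (S T : finType) (P : S -> R)
    (A : S -> T -> R) : T -> R :=
  fun y => \sum_x P x * A x y.

(* The terms with P(x)V(x'|x) = 0 vanish, as required by 0 log 0 = 0; in the
   other terms both arguments of the quotient are positive. *)
Definition mutual_info (R : realType) (X : finType) (P : X -> R)
    (V : X -> X -> R) : R :=
  \sum_x \sum_x' P x * V x x' * ln (V x x' / out_dist P V x').

Definition dotr (R : realType) (T : finType) (u v : T -> R) : R :=
  \sum_t u t * v t.

Definition psi (R : realType) (X Y : finType) (W : X -> Y -> R) (x : X) :
    Y -> R :=
  fun y => Num.sqrt (W x y).

(* The tensor product of n vectors of R^Y, as a vector of R^(Y^n). *)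
Definition psin (R : realType) (X Y : finType) (W : X -> Y -> R) (n : nat)
    (x : {ffun 'I_n -> X}) : {ffun 'I_n -> Y} -> R :=
  fun y => \prod_(i < n) psi W (x i) (y i).

Lemma dotr_psin (R : realType) (X Y : finType) (W : X -> Y -> R) (n : nat)
    (x x' : {ffun 'I_n -> X}) :
  dotr (psin W x) (psin W x') =
  \prod_(i < n) dotr (psi W (x i)) (psi W (x' i)).
Proof.
rewrite /dotr /psin bigA_distr_bigA /=.
by apply: eq_bigr => y _; rewrite big_split.
Qed.

(* Complex Hilbert spaces, of arbitrary dimension. A real Hilbert space embeds
   isometrically in its complexification, so nothing is lost by not considering
   real scalars separately. *)
Record hilbert (R : realType) := Hilbert {
  hspace :> completeNormedModType R[i];
  hdot : {dot hspace for Num.conj};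
  hdotE : forall u : hspace, `|u| ^+ 2 = hdot u u }.

(* u^dagger v; the library's forms are linear in the first argument. *)
Definition braket (R : realType) (H : hilbert R) (u v : H) : R[i] :=
  hdot H v u.

Definition Gamma (R : realType) (X Y : finType) (W : X -> Y -> R) (rho : R)
    (H : hilbert R) : set (X -> H) :=
  [set phi | (forall x, `|phi x| = 1) /\
     forall x x', Normc.normc (braket (phi x) (phi x'))
                  <= dotr (psi W x) (psi W x') `^ rho^-1].

(* [lne] and the extended inverse satisfy log(1/0) = +oo, and 0 * +oo = 0 in
   \bar R. *)
Definition log_cost (R : realType) (X : finType) (H : hilbert R) (Q : X -> R)
    (phi : X -> H) (f : H) : \bar R :=
  (\sum_x (Q x)%:E * lne ((Normc.normc (braket (phi x) f) ^+ 2)%:E^-1))%E.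

(* The minimum over all Hilbert spaces, representations and unit vectors is
   written as an infimum of extended reals. *)
Definition vartheta (R : realType) (X Y : finType) (W : X -> Y -> R) (rho : R)
    (Q : X -> R) : \bar R :=
  ereal_inf [set c | exists (H : hilbert R) (phi : X -> H) (f : H),
    [/\ Gamma W rho phi, `|f| = 1 & c = log_cost Q phi f]].

Definition vartheta_cond (R : realType) (X Y : finType) (W : X -> Y -> R)
    (rho : R) (P : X -> R) (V : X -> X -> R) : \bar R :=
  (\sum_x (P x)%:E * vartheta W rho (V x))%E.

Definition composition (R : realType) (X : finType) (n : nat)
    (x : {ffun 'I_n -> X}) : X -> R :=
  fun a => #|[pred i | x i == a]|%:R / n%:R.

Definition rate (R : realType) (X : finType) (n : nat)
    (C : {set {ffun 'I_n -> X}}) : R :=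
  n%:R^-1 * ln #|C|%:R.

Definition max_overlap (R : realType) (X Y : finType) (W : X -> Y -> R)
    (n : nat) (C : {set {ffun 'I_n -> X}}) : R :=
  \big[Num.max/0]_(x in C) \big[Num.max/0]_(x' in C | x != x')
    dotr (psin W x) (psin W x').

(* For a single codeword [max_overlap] is an empty maximum, equal to 0, and the
   distance is +oo; codes of positive rate have at least two codewords. *)
Definition code_dist (R : realType) (X Y : finType) (W : X -> Y -> R) (n : nat)
    (C : {set {ffun 'I_n -> X}}) : \bar R :=
  (- ((n%:R^-1)%:E * lne (max_overlap W C)%:E))%E.

(* Sequences of nonempty codes [C k] of block-lengths [n k] --> oo, of rate at
   least r and of constant composition [Q k] --> P. *)
Definition code_sequence (R : realType) (X : finType) (r : R) (P : X -> R)
    (n : nat -> nat) (C : forall k, {set {ffun 'I_(n k) -> X}})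
    (Q : nat -> X -> R) : Prop :=
  [/\ n @ \oo --> \oo,
      (forall k, [/\ (0 < n k)%N, C k != finset.set0 & r <= rate R (C k)]),
      (forall k x, x \in C k -> composition R x = Q k)
    & (forall a, Q k a @[k --> \oo] --> P a)].

Definition asymp_min_dist (R : realType) (X Y : finType) (W : X -> Y -> R)
    (r : R) (P : X -> R) : \bar R :=
  ereal_sup [set d | exists (n : nat -> nat)
                            (C : forall k, {set {ffun 'I_(n k) -> X}})
                            (Q : nat -> X -> R),
    code_sequence r P C Q /\
    d = limn_esup (fun k => code_dist W (C k))].

(* Main.v *)
(* An Elias-type argument.  Codewords are seen through random centers
   [z \in Z^n], [Z = X + X]: at each position a center letter chooses the
   representation and the handle [f] that are nearly optimal for
   [vartheta rho (V z_i)].  Centers are drawn i.i.d.; changing the measure to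
   the backward channel of [V] shows that each codeword is typical for a center
   with probability at least [exp (- n (I(P,V) + eps)) / 2], so some center has
   [N >= exp (n (R - I(P,V) - eps)) / 2] typical codewords.  For these the tensor
   products of the representations have squared overlap at least
   [exp (- n (vartheta rho P V + eps))] with the tensor product of the handles,
   which by the Cauchy-Schwarz inequality is impossible for such an [N] unless
   two of them have an overlap of that order.  Complex Hilbert spaces are
   replaced by real coordinates: after a change of phases only the real part of
   the Gram matrix matters, and it is factored. *)
Require Import Defs.
From mathcomp Require Import all_boot all_order all_algebra.
From mathcomp Require Import all_classical all_reals all_analysis.
From mathcomp Require Import complex ring lra.
Import Order.TTheory GRing.Theory Num.Theory.
Import numFieldNormedType.Exports.
Local Open Scope classical_set_scope.
Local Open Scope ring_scope.

Set Implicit Arguments.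
Unset Strict Implicit.

(** * Positive semidefinite kernels and their Gram factorization *)

Lemma sum_delta (R : pzSemiRingType) (T : finType) (t : T) (F : T -> R) :
  \sum_i (i == t)%:R * F i = F t.
Proof.
rewrite (bigD1 t) //= eqxx mul1r big1 ?addr0 // => i /negbTE ->.
by rewrite mul0r.
Qed.

Definition psd (R : numDomainType) (T : finType) (k : T -> T -> R) : Prop :=
  forall c : T -> R, 0 <= \sum_i \sum_j c i * c j * k i j.

(** Along a coordinate axis the quadratic form is a quadratic polynomial in the step [s]; the next
    lemmas differ only in the choice of [s]. *)
Lemma quad_sub_delta (R : comPzRingType) (T : finType) (k : T -> T -> R)
    (c : T -> R) (t : T) (s : R) (ksym : forall i j, k i j = k j i) :
  let c' i := c i - s * (i == t)%:R in
  \sum_i \sum_j c' i * c' j * k i j =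
  \sum_i \sum_j c i * c j * k i j - 2 * s * (\sum_i c i * k i t)
  + s ^+ 2 * k t t.
Proof.
move=> c'.
have row i : \sum_j c' i * c' j * k i j =
    \sum_j c i * c j * k i j - s * (c i * k i t)
    - (i == t)%:R * (s * \sum_j c j * k i j) + (i == t)%:R * (s ^+ 2 * k i t).
  rewrite -(sum_delta t (fun j => s * (c i * k i j))).
  rewrite -(sum_delta t (fun j => s ^+ 2 * k i j)) !mulr_sumr.
  rewrite -!sumrB -big_split /=; apply: eq_bigr => j _; rewrite /c'.
  by ring.
rewrite (eq_bigr _ (fun i _ => row i)) big_split /= !sumrB !sum_delta.
have -> : \sum_j c j * k t j = \sum_j c j * k j t.
  by apply: eq_bigr => j _; rewrite ksym.
rewrite -mulr_sumr; by ring.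
Qed.

Lemma psd_diag_ge0 (R : numDomainType) (T : finType) (k : T -> T -> R)
  (kpos : psd k) (t : T) : 0 <= k t t.
Proof.
have := kpos (fun i => (i == t)%:R).
rewrite (eq_bigr (fun i => (i == t)%:R * k i t)) ?sum_delta // => i _.
rewrite -(sum_delta t (fun j => k i j)) mulr_sumr.
by apply: eq_bigr => j _; rewrite mulrA.
Qed.

Lemma psd_diag_eq0 (R : realFieldType) (T : finType) (k : T -> T -> R)
    (ksym : forall i j, k i j = k j i) (kpos : psd k) (t : T) :
  k t t = 0 -> forall i, k i t = 0.
Proof.
move=> kt i; apply/eqP/negPn/negP => b0.
pose c j : R := (j == i)%:R.
pose q := \sum_i \sum_j c i * c j * k i j.
(* With [k t t = 0] the form is affine in the step; this step brings its value to
   [q - (q + 1) = -1]. *)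
have := kpos (fun j => c j - (q + 1) / (2 * k i t) * (j == t)%:R).
rewrite quad_sub_delta // kt mulr0 addr0 sum_delta -/q.
have -> : 2 * ((q + 1) / (2 * k i t)) * k i t = q + 1 by field.
by lra.
Qed.

(** The Schur complement at [c] is the minimum of the original form over shifts of [c] along [t],
    attained at the step [b / k t t]. *)
Lemma psd_schur_complement (R : realFieldType) (T : finType) (k : T -> T -> R)
    (ksym : forall i j, k i j = k j i) (kpos : psd k) (t : T) :
  0 < k t t -> psd (fun i j => k i j - k i t * k j t / k t t).
Proof.
move=> kt c; pose b := \sum_i c i * k i t.
have := kpos (fun i => c i - b / k t t * (i == t)%:R).
rewrite quad_sub_delta // -/b.
have -> : 2 * (b / k t t) * b = 2 * (b ^+ 2 / k t t) by field; lra.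
have -> : (b / k t t) ^+ 2 * k t t = b ^+ 2 / k t t by field; lra.
rewrite [X in _ -> 0 <= X](_ : _ =
  \sum_i \sum_j c i * c j * k i j - b ^+ 2 / k t t); first by lra.
rewrite expr2 -mulrA [in b * _]/b mulr_suml -sumrB; apply: eq_bigr => i _.
rewrite /b mulr_suml mulr_sumr -sumrB; apply: eq_bigr => j _.
by ring.
Qed.

(* Cholesky factorization: each step passes to a Schur complement. *)
Lemma psd_gram (R : rcfType) (T : finType) (k : T -> T -> R)
    (ksym : forall i j, k i j = k j i) (kpos : psd k) :
  exists u : T -> T -> R, forall i j, \sum_t u i t * u j t = k i j.
Proof.
(* The extra clause keeps the column of [u] at a vanishing diagonal entry equal to zero, so that the
   induction can store a new column there. *)
suff: exists u : T -> T -> R, (forall i j, \sum_t u i t * u j t = k i j) /\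
    forall t, k t t = 0 -> forall i, u i t = 0 by case=> u [? _]; exists u.
have [N] := ubnP #|[pred t | k t t != 0]|.
elim: N k ksym kpos => // N IHN k ksym kpos cardN.
have [/forallP k0|] := boolP [forall t, k t t == 0].
  exists (fun _ _ => 0); split=> // i j.
  rewrite big1 => [|t _]; last by rewrite mul0r.
  by rewrite (psd_diag_eq0 ksym) //; apply/eqP.
rewrite negb_forall => /existsP[t kt0].
have kt : 0 < k t t by rewrite lt_def kt0 psd_diag_ge0.
pose k' i j := k i j - k i t * k j t / k t t.
have kpos' : psd k' by exact: psd_schur_complement.
have kt' : k' t t = 0 by rewrite /k'; field.
have le_k' s : k' s s <= k s s.
  by rewrite /k' gerBl divr_ge0 ?(ltW kt) // -expr2 sqr_ge0.
have k'0 s : k s s = 0 -> k' s s = 0.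
  move=> ks; apply/eqP; rewrite eq_le psd_diag_ge0 // andbT.
  by rewrite -ks le_k'.
have [||u [gram_u u0]] := IHN k' _ kpos'.
- by move=> i j; rewrite /k' ksym [k i t * _]mulrC.
- rewrite ltnS in cardN; apply: leq_trans cardN; apply/proper_card/properP; split.
    by apply/fintype.subsetP => s; rewrite !inE; apply: contra => /eqP/k'0 ->.
  by exists t; rewrite !inE ?kt' ?eqxx.
(* Column [t] is zero in the factor of the Schur complement; filling it adds back exactly the
   subtracted rank-one term. *)
exists (fun i s => if s == t then k i t / Num.sqrt (k t t) else u i s).
split=> [i j|s ks i]; last first.
  by have [st|_] := eqVneq s t; [rewrite -st ks eqxx in kt0 | rewrite u0 ?k'0].
rewrite (bigD1 t) //= eqxx.
rewrite (eq_bigr (fun s => u i s * u j s)); last by move=> s /negbTE ->.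
have := gram_u i j; rewrite (bigD1 t) //= u0 // mul0r add0r => ->.
rewrite /k' mulrACA -invfM -expr2 sqr_sqrtr ?ltW //; by ring.
Qed.

(** * From complex Hilbert spaces to real coordinates *)

Lemma hdotC (R : realType) (H : hilbert R) (u v : H) :
  hdot H u v = (hdot H v u)^*.
Proof. by rewrite hermC expr0 mul1r. Qed.

Lemma hdotZ (R : realType) (H : hilbert R) (a b : R[i]) (u v : H) :
  hdot H (a *: u) (b *: v) = a * b^* * hdot H u v.
Proof. by rewrite (linearZl_LR (hdot H)) (linearZr_LR (hdot H)) /= mulrA. Qed.

Lemma hdot_suml (R : realType) (H : hilbert R) (I : finType) (F : I -> H)
  (v : H) : hdot H (\sum_i F i) v = \sum_i hdot H (F i) v.
Proof. exact: linear_sumlz. Qed.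

Lemma hdot_sumr (R : realType) (H : hilbert R) (I : finType) (F : I -> H)
  (v : H) : hdot H v (\sum_i F i) = \sum_i hdot H v (F i).
Proof. exact: linear_sumr. Qed.

Lemma Re_sum (R : rcfType) (I : finType) (F : I -> R[i]) :
  complex.Re (\sum_i F i) = \sum_i complex.Re (F i).
Proof. exact: raddf_sum. Qed.

(** On real coefficients the quadratic form of the real part of the Gram matrix is the squared norm
    of a linear combination, so [psd_gram] applies. *)
Lemma hilbert_gram (R : realType) (H : hilbert R) (T : finType) (v : T -> H) :
  exists u : T -> T -> R, forall i j,
    dotr (u i) (u j) = complex.Re (hdot H (v i) (v j)).
Proof.
apply: psd_gram => [i j|c].
  by rewrite hdotC; case: (hdot H _ _).
pose w := \sum_i (c i)%:C%C *: v i.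
have : 0 <= hdot H w w by rewrite -hdotE exprn_ge0.
suff -> : \sum_i \sum_j c i * c j * complex.Re (hdot H (v i) (v j)) =
    complex.Re (hdot H w w) by case: (hdot H w w) => a b; rewrite lecE => /andP[].
rewrite /w hdot_suml Re_sum; apply: eq_bigr => i _.
rewrite hdot_sumr Re_sum; apply: eq_bigr => j _.
have cR : (c j)%:C%C^* = (c j)%:C%C by exact: conjc_real.
rewrite hdotZ cR -rmorphM.
by case: (hdot H _ _) => a b; simpc.
Qed.

(* Multiplying [phi x] by a phase makes its product with [f] nonnegative. *)
Lemma real_representation (R : realType) (X : finType) (H : hilbert R) (phi : X -> H)
    (f : H) (phi1 : forall x, `|phi x| = 1) (f1 : `|f| = 1) :
  exists (u : X -> option X -> R) (g : option X -> R),
    [/\ forall x, dotr (u x) (u x) = 1, dotr g g = 1,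
        forall x, dotr (u x) g = Normc.normc (braket (phi x) f)
      & forall x x', `|dotr (u x) (u x')| <=
                     Normc.normc (braket (phi x) (phi x'))].
Proof.
pose h x := hdot H (phi x) f.
pose e x := if h x == 0 then 1 else `|h x| / h x.
have e1 x : `|e x| = 1.
  rewrite /e; case: ifPn => [_|h0]; first by rewrite normr1.
  by rewrite normrM normfV normr_id mulfV // normr_eq0.
have eh x : e x * h x = `|h x|.
  by rewrite /e; case: ifPn => [/eqP->|h0]; rewrite ?mulr0 ?normr0 ?divfK.
have normC u w : Normc.normc (braket u w) = Normc.normc (hdot H u w).
  rewrite /braket hdotC; case: (hdot H u w) => a b /=.
  by rewrite sqrrN.
(* One family for both kinds of vector: [None] stands for the handle, [Some x] for the rotated
   representation. *)
pose v o := if o is Some x then e x *: phi x else f.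
have [w gram_w] := hilbert_gram v.
exists (fun x => w (Some x)), (w None); split=> [x|||x x'].
- rewrite gram_w /= hdotZ -hdotE phi1 expr1n mulr1.
  by rewrite -normCK e1 expr1n.
- by rewrite gram_w /= -hdotE f1 expr1n.
- move=> x; rewrite gram_w /= -[f]scale1r hdotZ rmorph1 mulr1 scale1r.
  by rewrite -/(h x) eh normC.
(* A real part is at most the modulus, and the unit phases drop out of the modulus. *)
rewrite gram_w normC -lecR; apply: le_trans (normc_ge_Re _) _.
by rewrite /= hdotZ !normrM norm_conjC !e1 !mul1r.
Qed.

(** Cauchy-Schwarz for a unit vector [b]: the residual of the projection of [a] on [b] has
    nonnegative squared length. *)
Lemma dotr_sqr_le (R : realFieldType) (D : finType) (a b : D -> R) :
  \sum_t b t * b t = 1 -> (\sum_t a t * b t) ^+ 2 <= \sum_t a t * a t.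
Proof.
move=> b1.
have expand s : \sum_t (a t - s * b t) ^+ 2 =
    \sum_t a t * a t - 2 * s * (\sum_t a t * b t) + s ^+ 2 * \sum_t b t * b t.
  rewrite !mulr_sumr -sumrB -big_split; apply: eq_bigr => t _ /=.
  by ring.
set s := \sum_t a t * b t.
have : 0 <= \sum_t (a t - s * b t) ^+ 2 by apply: sumr_ge0 => t _; exact: sqr_ge0.
by rewrite expand b1 -/s; lra.
Qed.

(** * Nearly optimal real representations for [vartheta] *)

Lemma lne_inv_sqr (R : realType) (c : R) : 0 < c ->
  lne (((c ^+ 2)%:E)^-1)%E = (- 2 * ln c)%:E.
Proof.
move=> c0; rewrite inver gt_eqF ?exprn_gt0 //.
rewrite lne_EFin ?invr_gt0 ?exprn_gt0 // lnV ?posrE ?exprn_gt0 //.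
by rewrite lnXn // -[_ *+ 2]mulr_natl mulNr.
Qed.

Lemma lne_inv_sqr0 (R : realType) : lne (((0 ^+ 2 : R)%:E)^-1)%E = +oo%E.
Proof. by rewrite inver expr0n /= eqxx. Qed.

Lemma lne_inv_sqr_ge0 (R : realType) (c : R) : 0 <= c -> c <= 1 ->
  (0 <= lne (((c ^+ 2)%:E)^-1))%E.
Proof.
rewrite le_eqVlt => /predU1P[<- _|c0 c1]; first by rewrite lne_inv_sqr0.
by rewrite lne_inv_sqr // lee_fin mulNr -mulrN mulr_ge0 // oppr_ge0 ln_le0.
Qed.

Lemma normc_ge0 (R : rcfType) (z : R[i]) : 0 <= Normc.normc z.
Proof. by case: z => a b; exact: sqrtr_ge0. Qed.

Lemma braket_le1 (R : realType) (H : hilbert R) (u f : H) :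
  `|u| = 1 -> `|f| = 1 -> Normc.normc (braket u f) <= 1.
Proof.
move=> u1 f1.
have [w [g [ww gg wg _]]] := real_representation (fun _ : unit => u1) f1.
rewrite -(wg tt) -[1](sqrtr1 R); apply: le_trans (ler_norm _) _.
by rewrite -sqrtr_sqr ler_wsqrtr // -(ww tt); exact: dotr_sqr_le.
Qed.

Lemma vartheta_ge0 (R : realType) (X Y : finType) (W : X -> Y -> R) (rho : R)
    (Q : X -> R) : is_dist Q -> (0 <= vartheta W rho Q)%E.
Proof.
move=> [Q0 _]; apply: le_ereal_inf_tmp => _ [H [phi [f [[phi1 _] f1 ->]]]].
apply: sume_ge0 => x _; apply: mule_ge0; first by rewrite lee_fin.
by apply: lne_inv_sqr_ge0; [exact: normc_ge0 | exact: braket_le1].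
Qed.

(** A value strictly below [v] occurs in the infimum, attained or not. Its cost is finite, which
    forces positive overlaps on the support of [Q] and makes the real logarithm faithful there. *)
Lemma vartheta_representation (R : realType) (X Y : finType) (W : X -> Y -> R)
    (rho : R) (Q : X -> R) (v : R) :
  is_dist Q -> (vartheta W rho Q < v%:E)%E ->
  exists (u : X -> option X -> R) (g : option X -> R),
    [/\ forall x, dotr (u x) (u x) = 1, dotr g g = 1,
        forall x x', `|dotr (u x) (u x')| <=
                     dotr (psi W x) (psi W x') `^ rho^-1,
        forall x, 0 < Q x -> 0 < dotr (u x) g
      & \sum_x Q x * (- 2 * ln (dotr (u x) g)) < v].
Proof.
move=> [Q0 Q1] /ereal_inf_lt[_ [H [phi [f [[phi1 phiW] f1 ->]]]] cv].
have [u [g [uu gg ug uu']]] := real_representation phi1 f1.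
have c_ge0 x : (0 <= lne (((Normc.normc (braket (phi x) f) ^+ 2)%:E)^-1))%E.
  by apply: lne_inv_sqr_ge0; [exact: normc_ge0 | exact: braket_le1].
have ug_gt0 x : 0 < Q x -> 0 < dotr (u x) g.
  move=> Qx; rewrite lt_def ug normc_ge0 andbT; apply/eqP => c0.
  have : (+oo <= log_cost Q phi f)%E.
    rewrite /log_cost (bigD1 x) //= c0 lne_inv_sqr0 gt0_muley ?lte_fin //.
    rewrite leeDl //; apply: sume_ge0 => y _.
    by rewrite mule_ge0 ?lee_fin.
  by rewrite leye_eq => /eqP cy; rewrite cy in cv.
exists u, g; split=> // [x x'|]; first exact: le_trans (uu' x x') (phiW x x').
rewrite -lte_fin; apply: le_lt_trans cv.
rewrite /log_cost -sumEFin; apply: lee_sum => x _.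
have [<-|Qx] := eqVneq 0 (Q x); first by rewrite mul0r mul0e.
rewrite -ug lne_inv_sqr ?EFinM //.
by rewrite ug_gt0 // lt_def eq_sym Qx Q0.
Qed.

(** * Exponential tail bounds for product distributions *)

Lemma sum_prod_ffun (R : comPzSemiRingType) (Z : finType) (n : nat)
    (F : 'I_n -> Z -> R) :
  \sum_(z : {ffun 'I_n -> Z}) \prod_i F i (z i) = \prod_i \sum_y F i y.
Proof. by rewrite bigA_distr_bigA. Qed.

(** Inverting [1 - t <= expR (- t)] leaves [1 / (1 - t) <= 1 + t + 2 * t ^+ 2], true on this
    range. *)
Lemma expR_quad_le (R : realType) (t : R) :
  `|t| <= 2^-1 -> expR t <= 1 + t + 2 * t ^+ 2.
Proof.
rewrite ler_norml => /andP[t_ge t_le].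
have t1 : 0 < 1 - t by lra.
rewrite -[expR t]invrK -expRN -[X in _ <= X]invrK lef_pV2 ?posrE ?expR_gt0 //.
  apply: le_trans (expR_ge1Dx (- t)).
  rewrite -[leLHS]mul1r ler_pdivrMr; first by nra.
  by nra.
by rewrite invr_gt0; nra.
Qed.

Lemma mgf_le (R : realType) (Z : finType) (q h : Z -> R) (s b : R) :
  is_dist q -> (forall y, `|h y| <= b) -> 0 <= s -> s * b <= 2^-1 ->
  \sum_y q y * expR (s * h y) <=
  expR (s * (\sum_y q y * h y) + 2 * (s * b) ^+ 2).
Proof.
move=> [q0 q1] hb s0 sb.
have term y : q y * expR (s * h y) <=
    q y + s * (q y * h y) + q y * (2 * (s * b) ^+ 2).
  have shb : `|s * h y| <= s * b by rewrite normrM ger0_norm // ler_wpM2l.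
  have sq : (s * h y) ^+ 2 <= (s * b) ^+ 2.
    by rewrite -[leLHS]real_normK ?num_real // lerXn2r ?nnegrE ?(le_trans _ shb).
  have := expR_quad_le (le_trans shb sb).
  by move: (q0 y) sq; nra.
apply: le_trans (expR_ge1Dx _).
apply: le_trans (ler_sum _ (fun y _ => term y)) _.
by rewrite !big_split /= -mulr_sumr -mulr_suml q1 mul1r addrA.
Qed.

(** Markov's inequality for the exponential of [s] times the sum, whose expectation factors over the
    positions. *)
Lemma chernoff (R : realType) (Z : finType) (n : nat) (q h : 'I_n -> Z -> R)
    (s b a : R) :
  (forall i, is_dist (q i)) -> (forall i y, `|h i y| <= b) ->
  0 <= s -> s * b <= 2^-1 ->
  \sum_(z : {ffun 'I_n -> Z} | a <= \sum_i h i (z i)) \prod_i q i (z i) <=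
  expR (s * (\sum_i \sum_y q i y * h i y) + n%:R * (2 * (s * b) ^+ 2) - s * a).
Proof.
move=> q1 hb s0 sb.
have prod_ge0 (z : {ffun 'I_n -> Z}) : 0 <= \prod_i q i (z i).
  by apply: prodr_ge0 => i _; case: (q1 i).
have -> : s * (\sum_i \sum_y q i y * h i y) + n%:R * (2 * (s * b) ^+ 2) =
    \sum_i (s * (\sum_y q i y * h i y) + 2 * (s * b) ^+ 2).
  by rewrite big_split /= -mulr_sumr sumr_const card_ord mulr_natl.
rewrite expRD -[X in X * _]mulr1 expR_sum mulr1.
apply: (@le_trans _ _ ((\prod_i \sum_y q i y * expR (s * h i y)) * expR (- (s * a)))).
  rewrite -sum_prod_ffun mulr_suml [leLHS]big_mkcond; apply: ler_sum => z _.
  case: ifP => [az|_]; last first.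
    rewrite mulr_ge0 ?expR_ge0 //; apply: prodr_ge0 => i _.
    by rewrite mulr_ge0 ?expR_ge0 //; case: (q1 i).
  rewrite big_split /= -mulrA ler_peMr // -expR_sum -expRD -mulr_sumr.
  apply: le_trans (expR_ge1Dx _).
  by rewrite lerDl subr_ge0 ler_wpM2l.
rewrite ler_wpM2r ?expR_ge0 //; apply: ler_prod => i _.
rewrite mgf_le // andbT; apply: sumr_ge0 => y _.
by rewrite mulr_ge0 ?expR_ge0 //; case: (q1 i).
Qed.

(** The point is uniformity: [kappa] depends neither on [n] nor on [x], because finite alphabets
    give one bound on [h]. *)
Lemma large_deviation (R : realType) (X Z : finType) (U h : X -> Z -> R)
    (a a' : R) : is_stochastic U -> a < a' ->
  exists2 kappa : R, 0 < kappa & forall n (x : {ffun 'I_n -> X}),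
    \sum_i \sum_y U (x i) y * h (x i) y <= n%:R * a ->
    \sum_(z : {ffun 'I_n -> Z} | n%:R * a' <= \sum_i h (x i) (z i))
      \prod_i U (x i) (z i) <= expR (- (n%:R * kappa)).
Proof.
move=> U1 aa'.
pose b : R := 1 + \sum_x \sum_y `|h x y|.
have s_ge0 : 0 <= \sum_x \sum_y `|h x y| by do 2!apply: sumr_ge0 => ? _.
have b1 : 1 <= b by rewrite lerDl.
have hb x y : `|h x y| <= b.
  rewrite /b (bigD1 x) //= (bigD1 y) //= -!addrA.
  have : 0 <= \sum_(i | i != y) `|h x i| by apply: sumr_ge0.
  have : 0 <= \sum_(i | i != x) \sum_y0 `|h i y0|.
    by do 2!apply: sumr_ge0 => ? _.
  by lra.
pose d := (a' - a) / (1 + (a' - a)).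
have d0 : 0 < d by rewrite divr_gt0; lra.
have d1 : d <= 1 by rewrite ler_pdivrMr; lra.
have da : d <= a' - a by rewrite ler_pdivrMr; nra.
(* This choice makes the quadratic term [2 * (s * b) ^+ 2] equal to [s * d / 2], at most half of the
   gain [s * (a' - a)]; the other half is [kappa]. *)
pose s := d / (4 * b ^+ 2).
have b0 : 0 < b by lra.
have b2 : 0 < 4 * b ^+ 2 by rewrite mulr_gt0 // exprn_gt0.
have s0 : 0 < s by rewrite divr_gt0.
have sb2 : s * b ^+ 2 = d / 4 by rewrite /s; field; lra.
have sb : s * b <= 2^-1 by move: sb2; nra.
exists (s * (a' - a) / 2) => [|n x xa].
  by rewrite divr_gt0 // mulr_gt0 // subr_gt0.
apply: le_trans (chernoff _ (fun i => U1 (x i)) (fun i y => hb (x i) y) (ltW s0) sb) _.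
rewrite ler_expR.
have := ler_wpM2l (ltW s0) xa.
have -> : (s * b) ^+ 2 = s * (d / 4) by rewrite -sb2; ring.
have : n%:R * s * d <= n%:R * s * (a' - a) by rewrite ler_wpM2l // mulr_ge0 // ltW.
by lra.
Qed.

(** * Tensor products and the Gram bound on the number of vectors *)

Definition tensor (R : realType) (D : finType) (n : nat) (u : 'I_n -> D -> R) :
    {ffun 'I_n -> D} -> R :=
  fun y => \prod_i u i (y i).

Lemma dotr_tensor (R : realType) (D : finType) (n : nat) (u v : 'I_n -> D -> R) :
  dotr (tensor u) (tensor v) = \prod_i dotr (u i) (v i).
Proof.
rewrite /dotr /tensor -sum_prod_ffun.
by apply: eq_bigr => y _; rewrite big_split.
Qed.

(* [|S| tau <= <sum w, f> <= |sum w|], squared and divided by [|S|]. *)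
Lemma gram_card_bound (R : realType) (T D : finType) (S : {set T})
    (w : T -> D -> R) (f : D -> R) (tau mu : R) :
  dotr f f = 1 -> (forall x, dotr (w x) (w x) = 1) -> 0 <= tau -> 0 <= mu ->
  (forall x, x \in S -> tau <= dotr (w x) f) ->
  (forall x x', x \in S -> x' \in S -> x != x' -> dotr (w x) (w x') <= mu) ->
  #|S|%:R * tau ^+ 2 <= 1 + #|S|%:R * mu.
Proof.
move=> f1 w1 tau0 mu0 wf ww.
have [->|S0] := posnP #|S|; first by rewrite !mul0r addr0.
have N0 : 0 < #|S|%:R :> R by rewrite ltr0n.
pose v t := \sum_(x in S) w x t.
have vf : #|S|%:R * tau <= dotr v f.
  have -> : dotr v f = \sum_(x in S) dotr (w x) f.
    by rewrite /dotr exchange_big; apply: eq_bigr => t _; rewrite mulr_suml.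
  rewrite mulr_natl -sumr_const; exact: ler_sum.
have vv : dotr v v <= #|S|%:R * (1 + #|S|%:R * mu).
  have -> : dotr v v = \sum_(x in S) \sum_(x' in S) dotr (w x) (w x').
    rewrite /dotr; under [RHS]eq_bigr do rewrite exchange_big /=.
    rewrite exchange_big; apply: eq_bigr => t _.
    rewrite mulr_suml; apply: eq_bigr => x _.
    by rewrite mulr_sumr.
  rewrite mulr_natl -sumr_const; apply: ler_sum => x xS.
  rewrite (bigD1 x) //= w1 lerD2l mulr_natl -sumr_const.
  rewrite [leRHS](bigD1 x) //= -[leLHS]add0r lerD //.
  by apply: ler_sum => x' /andP[x'S x'x]; rewrite ww // eq_sym.
have vf2 : (#|S|%:R * tau) ^+ 2 <= dotr v f ^+ 2.
  by rewrite lerXn2r ?nnegrE ?(le_trans _ vf) ?mulr_ge0 ?ler0n.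
have := le_trans vf2 (le_trans (dotr_sqr_le v f1) vv).
by rewrite exprMn expr2 -!mulrA ler_pM2l.
Qed.

(** * Typical centers and the choice of a popular one *)

Lemma exists_ge_mean (R : realDomainType) (T : finType) (p F : T -> R) :
  (forall t, 0 <= p t) -> \sum_t p t = 1 ->
  exists t, \sum_t p t * F t <= F t.
Proof.
move=> p0 p1; set m := \sum_t _.
have [//|/forallNP Fm] := pselect (exists t, m <= F t).
have lt_m t : F t < m by rewrite ltNge; apply/negP.
have sum0 : \sum_t p t * (m - F t) = 0.
  under eq_bigr do rewrite mulrBr.
  by rewrite sumrB -mulr_suml p1 mul1r subrr.
have p_eq0 t : p t = 0.
  have /eqP : p t * (m - F t) = 0.
    have ge0 i : true -> 0 <= p i * (m - F i).
      by move=> _; rewrite mulr_ge0 ?subr_ge0 ?(ltW (lt_m i)).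
    exact: (psumr_eq0P ge0 sum0).
  by rewrite mulf_eq0 [m - _ == 0]gt_eqF ?subr_gt0 ?orbF // => /eqP.
by move: p1; rewrite big1 // => /eqP; rewrite eq_sym oner_eq0.
Qed.

(** Average over [z] drawn from [p]: by the change of measure, each [x] in [C] has good centers of
    [p]-mass at least [1 / (2 * K)]. *)
Lemma exists_center (R : realType) (T Z : finType) (C : {set T}) (p : Z -> R)
    (u : T -> Z -> R) (good : T -> Z -> bool) (K : R) :
  is_dist p -> 0 <= K ->
  (forall x, x \in C -> 2^-1 <= \sum_(z | good x z) u x z) ->
  (forall x z, good x z -> u x z <= K * p z) ->
  exists z, #|C|%:R <= 2 * K * #|[set x in C | good x z]|%:R.
Proof.
move=> [p0 p1] K0 mass_good u_le.
pose N z : R := #|[set x in C | good x z]|%:R.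
have [z Nz] := exists_ge_mean (fun z => 2 * K * N z) p0 p1.
exists z; apply: le_trans Nz.
have -> : \sum_z p z * (2 * K * N z) =
    2 * \sum_(x in C) \sum_(z | good x z) K * p z.
  rewrite (exchange_big_dep xpredT) //= mulr_sumr; apply: eq_bigr => z' _.
  rewrite sumr_const /N -mulr_natr.
  have -> : #|[set x in C | good x z']| = #|[pred x in C | good x z']|.
    by apply: eq_card => x; rewrite !inE.
  by ring.
have : #|C|%:R * 2^-1 <= \sum_(x in C) \sum_(z | good x z) K * p z.
  rewrite mulr_natl -sumr_const; apply: ler_sum => x xC.
  by apply: le_trans (mass_good x xC) _; apply: ler_sum => z' /u_le.
by lra.
Qed.

(** Positivity rules out the default value [ln 0 = 0]; the bound on [L] controls the likelihood
    ratio, the bound on [c] the overlap with the handles. *)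
Definition typical (R : realType) (X Z : finType) (U L c : X -> Z -> R)
    (a b : R) (n : nat) (x : {ffun 'I_n -> X}) (z : {ffun 'I_n -> Z}) : bool :=
  [&& [forall i, 0 < U (x i) (z i)], \sum_i L (x i) (z i) < n%:R * a
    & \sum_i c (x i) (z i) < n%:R * b].

Lemma typical_mass (R : realType) (X Z : finType) (U L c : X -> Z -> R)
    (a b : R) (n : nat) (x : {ffun 'I_n -> X}) :
  is_stochastic U ->
  \sum_(z : {ffun 'I_n -> Z} | n%:R * a <= \sum_i L (x i) (z i))
    \prod_i U (x i) (z i) <= 4^-1 ->
  \sum_(z : {ffun 'I_n -> Z} | n%:R * b <= \sum_i c (x i) (z i))
    \prod_i U (x i) (z i) <= 4^-1 ->
  2^-1 <= \sum_(z | typical U L c a b x z) \prod_i U (x i) (z i).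
Proof.
move=> U1 badL badc.
have mass1 : \sum_(z : {ffun 'I_n -> Z}) \prod_i U (x i) (z i) = 1.
  by rewrite (sum_prod_ffun (fun i => U (x i))) big1 // => i _; case: (U1 (x i)).
set good := leRHS.
have : \sum_(z : {ffun 'I_n -> Z}) \prod_i U (x i) (z i) <= good +
    \sum_(z : {ffun 'I_n -> Z} | n%:R * a <= \sum_i L (x i) (z i))
      \prod_i U (x i) (z i) +
    \sum_(z : {ffun 'I_n -> Z} | n%:R * b <= \sum_i c (x i) (z i))
      \prod_i U (x i) (z i).
  rewrite /good [X in _ <= X + _ + _]big_mkcond.
  rewrite [X in _ <= _ + X + _]big_mkcond [X in _ <= _ + _ + X]big_mkcond.
  rewrite -!big_split /=; apply: ler_sum => z _.
  have U0 i : 0 <= U (x i) (z i) by case: (U1 (x i)).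
  have prod0 : 0 <= \prod_i U (x i) (z i) by exact: prodr_ge0.
  rewrite /typical; case: forallP => [_|Ueq0] /=.
    rewrite (ltNge _ (n%:R * a)) (ltNge _ (n%:R * b)).
    by case: (n%:R * a <= _); case: (n%:R * b <= _) => /=; lra.
  (* A center violating positivity has product weight zero, so the union bound involves only the two
     tails. *)
  have /existsNP[i /negP] := Ueq0; rewrite lt_def U0 andbT negbK => /eqP Ui.
  by rewrite (bigD1 i) //= Ui mul0r !if_same !addr0.
by rewrite mass1; lra.
Qed.

(** * The overlap bound for a code of fixed length *)

Lemma dotr_psi_ge0 (R : realType) (X Y : finType) (W : X -> Y -> R) (x x' : X) :
  0 <= dotr (psi W x) (psi W x').
Proof. by apply: sumr_ge0 => y _; rewrite mulr_ge0 ?sqrtr_ge0. Qed.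

Lemma powR_prod (R : realType) (I : finType) (F : I -> R) (r : R) :
  (forall i, 0 <= F i) -> \prod_i F i `^ r = (\prod_i F i) `^ r.
Proof.
move=> F0; suff: \prod_i F i `^ r = (\prod_i F i) `^ r /\ 0 <= \prod_i F i.
  by case.
elim/big_ind2: _ => [|x a y b [-> a0] [-> b0]|i _] //.
  by rewrite powR1.
by rewrite powRM // mulr_ge0.
Qed.

Lemma max_overlap_ge0 (R : realType) (X Y : finType) (W : X -> Y -> R) (n : nat)
  (C : {set {ffun 'I_n -> X}}) : 0 <= max_overlap W C.
Proof. exact: bigmax_ge_id. Qed.

Lemma le_max_overlap (R : realType) (X Y : finType) (W : X -> Y -> R) (n : nat)
    (C : {set {ffun 'I_n -> X}}) (x x' : {ffun 'I_n -> X}) :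
  x \in C -> x' \in C -> x != x' ->
  \prod_i dotr (psi W (x i)) (psi W (x' i)) <= max_overlap W C.
Proof.
move=> xC x'C xx'; rewrite -dotr_psin /max_overlap.
apply: le_trans (le_bigmax_cond _ _ xC).
by apply: (le_bigmax_cond _ (fun x' => dotr (psin W x) (psin W x'))); rewrite x'C.
Qed.

(** [N] counts the codewords typical for a popular center; the second bound is [gram_card_bound] for
    their tensor representations, with threshold [expR (- (n%:R * b) / 2)]. *)
Lemma block_overlap (R : realType) (X Y Z D : finType) (W : X -> Y -> R)
    (rho : R) (U : X -> Z -> R) (p : Z -> R) (u : Z -> X -> D -> R)
    (g : Z -> D -> R) (a b : R) (n : nat) (C : {set {ffun 'I_n -> X}}) :
  0 <= rho -> is_stochastic U -> is_dist p ->
  (forall x z, 0 < U x z -> 0 < p z /\ 0 < dotr (u z x) (g z)) ->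
  (forall z x, dotr (u z x) (u z x) = 1) -> (forall z, dotr (g z) (g z) = 1) ->
  (forall z x x', `|dotr (u z x) (u z x')| <=
                  dotr (psi W x) (psi W x') `^ rho^-1) ->
  let L x z := ln (U x z / p z) in
  let c x z := - 2 * ln (dotr (u z x) (g z)) in
  (forall x, x \in C ->
     2^-1 <= \sum_(z | typical U L c a b x z) \prod_i U (x i) (z i)) ->
  exists2 N : R, #|C|%:R <= 2 * expR (n%:R * a) * N &
    N * expR (- (n%:R * b)) <= 1 + N * (max_overlap W C `^ rho^-1).
Proof.
move=> rho0 U1 [p0 p1] Upos uu gg uW L c massC.
pose pn (z : {ffun 'I_n -> Z}) := \prod_i p (z i).
have pn1 : is_dist pn.
  split=> [z|]; first exact: prodr_ge0.
  by rewrite (sum_prod_ffun (fun _ => p)) big1.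
have ratio (x : {ffun 'I_n -> X}) z : typical U L c a b x z ->
    \prod_i U (x i) (z i) <= expR (n%:R * a) * pn z.
  case/and3P=> /forallP Uxz Lxz _.
  have -> : \prod_i U (x i) (z i) = expR (\sum_i L (x i) (z i)) * pn z.
    rewrite expR_sum -big_split; apply: eq_bigr => i _ /=.
    have [pz _] := Upos _ _ (Uxz i).
    by rewrite lnK ?posrE ?divr_gt0 // divfK // gt_eqF.
  by rewrite ler_wpM2r ?(pn1.1) // ler_expR ltW.
have [z Cz] := exists_center pn1 (expR_ge0 _) massC ratio.
exists #|[set x in C | typical U L c a b x z]|%:R => //.
pose w (x : {ffun 'I_n -> X}) := tensor (fun i => u (z i) (x i)).
pose f := tensor (fun i => g (z i)).
have half : expR (- (n%:R * b)) = expR (- (n%:R * b) / 2) ^+ 2.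
  by rewrite -expRM_natl; congr expR; field.
rewrite half; apply: (@gram_card_bound _ _ _ _ w f).
- by rewrite dotr_tensor big1.
- by move=> x; rewrite dotr_tensor big1.
- exact: expR_ge0.
- exact: powR_ge0.
- move=> x; rewrite inE => /andP[_ /and3P[/forallP Uxz _ cxz]].
  have -> : dotr (w x) f = expR (- (\sum_i c (x i) (z i)) / 2).
    rewrite dotr_tensor -sumrN mulr_suml expR_sum; apply: eq_bigr => i _.
    have [_ ug] := Upos _ _ (Uxz i).
    rewrite /c (_ : - _ / 2 = ln (dotr (u (z i) (x i)) (g (z i)))); last by field.
    by rewrite lnK ?posrE.
  by rewrite ler_expR ler_pM2r // lerN2 ltW.
move=> x x'; rewrite !inE => /andP[xC _] /andP[x'C _] xx'.
rewrite dotr_tensor; apply: le_trans (ler_norm _) _; rewrite normr_prod.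
apply: (@le_trans _ _ (\prod_i dotr (psi W (x i)) (psi W (x' i)) `^ rho^-1)).
  by apply: ler_prod => i _; rewrite normr_ge0 uW.
rewrite powR_prod; last by move=> i; exact: dotr_psi_ge0.
apply: ge0_ler_powR; rewrite ?nnegrE ?invr_ge0 ?max_overlap_ge0 //.
  by apply: prodr_ge0 => i _; exact: dotr_psi_ge0.
exact: le_max_overlap.
Qed.

(** * Asymptotics along a sequence of codes *)

Lemma sum_composition (R : realType) (X : finType) (n : nat)
    (x : {ffun 'I_n -> X}) (F : X -> R) :
  (0 < n)%N -> \sum_i F (x i) = n%:R * \sum_a composition R x a * F a.
Proof.
move=> n0; rewrite mulr_sumr (partition_big x xpredT) //=.
apply: eq_bigr => a _.
rewrite (eq_bigr (fun=> F a)) => [|i /eqP-> //].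
rewrite sumr_const /composition mulrA mulrCA divff ?pnatr_eq0 -?lt0n //.
by rewrite mulr1 mulr_natl.
Qed.

Lemma expRN_le_quarter (R : realType) (t : R) : 3 <= t -> expR (- t) <= 4^-1.
Proof.
move=> t3; rewrite expRN lef_pV2 ?posrE ?expR_gt0 //.
by apply: le_trans (expR_ge1Dx t); lra.
Qed.

(** All codewords of [C k] share the mean of [F] under [Q k], which converges to the mean under [P];
    the strict inequality absorbs the difference. *)
Lemma code_sequence_mean (R : realType) (X : finType) (r : R) (P : X -> R)
    (n : nat -> nat) (C : forall k, {set {ffun 'I_(n k) -> X}})
    (Q : nat -> X -> R) (F : X -> R) (a : R) :
  code_sequence r P C Q -> \sum_x P x * F x < a ->
  \forall k \near \oo, forall x, x \in C k ->
    \sum_i F (x i) <= (n k)%:R * a.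
Proof.
move=> [_ nC compC cvgQ] Fa.
have cvgF : (\sum_x Q k x * F x @[k --> \oo] --> \sum_x P x * F x)%classic.
  apply: cvg_big => [|x _]; first exact: add_continuous.
  by apply: cvgM; [exact: cvgQ | exact: cvg_cst].
near=> k => x xC; have [n0 _ _] := nC k.
rewrite sum_composition // ler_wpM2l //.
under eq_bigr do rewrite (compC k x xC).
by apply: ltW; near: k; exact: (cvgr_lt _ cvgF).
Unshelve. all: by end_near.
Qed.

Lemma code_size_ge (R : realType) (X : finType) (r : R) (n : nat)
    (C : {set {ffun 'I_n -> X}}) :
  (0 < n)%N -> C != finset.set0 -> r <= rate R C -> expR (n%:R * r) <= #|C|%:R.
Proof.
move=> n0 C0; rewrite /rate ler_pdivlMl ?ltr0n // => rC.
have C1 : 0 < #|C|%:R :> R by rewrite ltr0n card_gt0.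
by rewrite -ler_ln ?posrE ?expR_gt0 // expRK.
Qed.

Lemma code_dist_le (R : realType) (X Y : finType) (W : X -> Y -> R) (n : nat)
    (C : {set {ffun 'I_n -> X}}) (rho b : R) :
  (0 < n)%N -> 0 < rho ->
  expR (- (n%:R * b)) <= max_overlap W C `^ rho^-1 ->
  (code_dist W C <= (rho * b)%:E)%E.
Proof.
move=> n0 rho0 mu_ge.
have mu0 : 0 < max_overlap W C.
  apply: (@gt0_powR _ _ rho^-1); rewrite ?invr_gt0 ?max_overlap_ge0 //.
  by apply: lt_le_trans mu_ge; exact: expR_gt0.
rewrite /code_dist lne_EFin // -EFinM -EFinN lee_fin.
move: mu_ge; rewrite -ler_ln ?posrE ?expR_gt0 ?powR_gt0 // expRK ln_powR.
rewrite ler_pdivlMl // => bmu; rewrite -mulrN ler_pdivrMl ?ltr0n //.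
by lra.
Qed.

(** Since [a + b < r], [N * expR (- (n%:R * b))] tends to infinity and the [1] in [block_overlap]
    becomes negligible. *)
Lemma eventually_code_dist_le (R : realType) (X Y Z D : finType)
    (W : X -> Y -> R) (rho : R) (U : X -> Z -> R) (p : Z -> R)
    (u : Z -> X -> D -> R) (g : Z -> D -> R) (P : X -> R) (a b b' r : R)
    (n : nat -> nat) (C : forall k, {set {ffun 'I_(n k) -> X}})
    (Q : nat -> X -> R) :
  0 < rho -> is_stochastic U -> is_dist p ->
  (forall x z, 0 < U x z -> 0 < p z /\ 0 < dotr (u z x) (g z)) ->
  (forall z x, dotr (u z x) (u z x) = 1) -> (forall z, dotr (g z) (g z) = 1) ->
  (forall z x x', `|dotr (u z x) (u z x')| <=
                  dotr (psi W x) (psi W x') `^ rho^-1) ->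
  let L x z := ln (U x z / p z) in
  let c x z := - 2 * ln (dotr (u z x) (g z)) in
  \sum_x P x * (\sum_z U x z * L x z) < a ->
  \sum_x P x * (\sum_z U x z * c x z) < b ->
  a + b < r -> b < b' ->
  code_sequence r P C Q ->
  \forall k \near \oo, (code_dist W (C k) <= (rho * b')%:E)%E.
Proof.
move=> rho0 U1 p1 Upos uu gg uW L c La cb abr bb' CQ.
have [noo nC _ _] := CQ.
(* The intermediate [a0] and [b0] split each gap: one half for the convergence of compositions, the
   other for the large deviations. *)
have [a0 [La0 a0a]] : exists a0, \sum_x P x * (\sum_z U x z * L x z) < a0 /\ a0 < a.
  by exists ((\sum_x P x * (\sum_z U x z * L x z) + a) / 2); lra.
have [b0 [cb0 b0b]] : exists b0, \sum_x P x * (\sum_z U x z * c x z) < b0 /\ b0 < b.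
  by exists ((\sum_x P x * (\sum_z U x z * c x z) + b) / 2); lra.
have [kL kL0 devL] := large_deviation L U1 a0a.
have [kc kc0 devc] := large_deviation c U1 b0b.
(* The constant 3 serves twice: [expR (- 3) <= 1 / 4] for the tails and for the factor lost below,
   and [1 + 3 = 2 * 2] for [two]. *)
have big_n (d : R) : 0 < d -> \forall k \near \oo, 3 <= (n k)%:R * d.
  move=> d0; near=> k; rewrite -ler_pdivrMr //.
  by near: k; exact: noo _ (nbhs_infty_ger _).
near=> k; have [n0 C0 rC] := nC k.
apply: code_dist_le => //.
have massC x : x \in C k ->
    2^-1 <= \sum_(z | typical U L c a b x z) \prod_i U (x i) (z i).
  move=> xC; apply: typical_mass => //.
    apply: le_trans (devL _ x _) (expRN_le_quarter _); last first.
      by near: k; exact: big_n.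
    by move: x xC; near: k; exact: code_sequence_mean CQ La0.
  apply: le_trans (devc _ x _) (expRN_le_quarter _); last first.
    by near: k; exact: big_n.
  by move: x xC; near: k; exact: code_sequence_mean CQ cb0.
have [N CN Nmu] := block_overlap (ltW rho0) U1 p1 Upos uu gg uW massC.
have CrN := le_trans (code_size_ge n0 C0 rC) CN.
set en := expR (- _); set mu := _ `^ _ in Nmu *.
set eb := expR (- _) in Nmu.
have eb0 : 0 < eb by exact: expR_gt0.
have two : 2 <= N * eb.
  have -> : N * eb = expR ((n k)%:R * a) * N * expR (- ((n k)%:R * (a + b))).
    by rewrite /eb mulrAC -expRD [LHS]mulrC; congr (expR _ * _); ring.
  have : expR ((n k)%:R * r) * expR (- ((n k)%:R * (a + b))) <=
      2 * (expR ((n k)%:R * a) * N) * expR (- ((n k)%:R * (a + b))).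
    by rewrite ler_wpM2r ?expR_ge0 // mulrA.
  rewrite -expRD -mulrN -mulrDr.
  have : 3 <= (n k)%:R * (r + - (a + b)) by near: k; apply: big_n; lra.
  have := expR_ge1Dx ((n k)%:R * (r + - (a + b))).
  by lra.
have N0 : 0 < N by rewrite -(pmulr_lgt0 _ eb0); lra.
(* By [two], the [1] in [Nmu] is at most half of [N * eb]. *)
have mu_ge : eb <= 2 * mu by rewrite -(ler_pM2l N0); lra.
(* The gap between [b] and [b'] pays for the factor 2. *)
have en_le : 2 * en <= eb.
  have -> : en = eb * expR (- ((n k)%:R * (b' - b))).
    by rewrite -expRD; congr expR; ring.
  have : expR (- ((n k)%:R * (b' - b))) <= 4^-1.
    by apply: expRN_le_quarter; near: k; apply: big_n; rewrite subr_gt0.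
  by move=> e4; rewrite mulrCA; rewrite -[leRHS]mulr1 ler_pM2l //; lra.
by lra.
Unshelve. all: by end_near.
Qed.

(** * The center distribution and the backward channel *)

(* The letters [inr b] serve the inputs of probability 0 under [P], which may
   still occur in codewords: their handle is the representation of [b] itself,
   so that the cost of [b] is 0 instead of possibly infinite. *)
Definition center_dist (R : realType) (X : finType) (P : X -> R) (eta : R)
    (z : X + X) : R :=
  match z with
  | inl a => expR (- eta) * P a
  | inr _ => (1 - expR (- eta)) / #|X|%:R
  end.

(** Bayes reversal of [V] with prior [P]; the divisor [P x] is the right one when [P] is also the
    output distribution. *)
Definition backward (R : realType) (X : finType) (P : X -> R) (V : X -> X -> R)
    (x : X) (z : X + X) : R :=
  match z with
  | inl a => if 0 < P x then P a * V a x / P x else 0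
  | inr b => if 0 < P x then 0 else (b == x)%:R
  end.

Lemma center_dist_is_dist (R : realType) (X : finType) (P : X -> R) (eta : R) :
  is_dist P -> 0 < eta -> is_dist (center_dist P eta).
Proof.
move=> [P0 P1] eta0.
have e1 : expR (- eta) <= 1 by rewrite -expR0 ler_expR lerNl oppr0 ltW.
split=> [[a|b]|] /=.
- by rewrite mulr_ge0 ?expR_ge0.
- by rewrite divr_ge0 ?subr_ge0 ?ler0n.
rewrite big_sumType /= -mulr_sumr P1 sumr_const -[X in _ + X]mulr_natr divfK; first by ring.
rewrite pnatr_eq0 -lt0n; apply/card_gt0P.
have [x|X0] := pselect (exists x : X, true); first by case: x => x _; exists x.
have : \sum_x P x = 0 by apply: big1 => x _; case: X0; exists x.
by rewrite P1 => /eqP; rewrite oner_eq0.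
Qed.

Lemma joint_eq0 (R : realType) (X : finType) (P : X -> R) (V : X -> X -> R)
    (a x : X) :
  is_dist P -> is_stochastic V -> (forall x, out_dist P V x = P x) ->
  P x = 0 -> P a * V a x = 0.
Proof.
move=> [P0 _] V1 PV Px.
have ge0 b : true -> 0 <= P b * V b x.
  by move=> _; rewrite mulr_ge0 //; case: (V1 b).
have sum0 : \sum_b P b * V b x = 0 by have := PV x; rewrite Px.
exact: (psumr_eq0P ge0 sum0).
Qed.

Lemma backward_is_stochastic (R : realType) (X : finType) (P : X -> R)
    (V : X -> X -> R) :
  is_dist P -> is_stochastic V -> (forall x, out_dist P V x = P x) ->
  is_stochastic (backward P V).
Proof.
move=> [P0 P1] V1 PV x; split=> [[a|b]|] /=.
- case: ifP => // _; rewrite !(divr_ge0, mulr_ge0) //.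
  by case: (V1 a).
- by case: ifP => // _; rewrite ler0n.
rewrite big_sumType /=; have [Px|Px] := boolP (0 < P x).
  have PVx : \sum_a P a * V a x = P x by exact: PV.
  by rewrite -mulr_suml big1_eq addr0 PVx divff // gt_eqF.
rewrite big1 // add0r -[RHS](sum_delta x (fun _ => 1)).
by apply: eq_bigr => b _; rewrite mulr1.
Qed.

(** Both sides average over the joint law [P a * V a x]; the letters [inr b] carry weight only where
    [P x = 0]. *)
Lemma backward_mean (R : realType) (X : finType) (P : X -> R)
    (V : X -> X -> R) (F : X -> X + X -> R) :
  is_dist P -> is_stochastic V -> (forall x, out_dist P V x = P x) ->
  \sum_x P x * (\sum_z backward P V x z * F x z) =
  \sum_a P a * (\sum_x V a x * F x (inl a)).
Proof.
move=> P1 V1 PV; under [RHS]eq_bigr do rewrite mulr_sumr.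
rewrite [RHS]exchange_big; apply: eq_bigr => x _ /=.
rewrite big_sumType /=; have [Px|Px] := boolP (0 < P x).
  rewrite [X in _ + X]big1 => [|b _]; last by rewrite mul0r.
  rewrite addr0 mulr_sumr; apply: eq_bigr => a _.
  by field; rewrite gt_eqF.
have {}Px : P x = 0 by apply/eqP; rewrite eq_le P1.1 andbT leNgt.
rewrite Px mul0r big1 // => a _.
by rewrite mulrA (joint_eq0 _ P1 V1 PV Px) mul0r.
Qed.

(** The excess [eta] is the price of the factor [expR (- eta)] by which [center_dist] scales [P]. *)
Lemma backward_log_mean (R : realType) (X : finType) (P : X -> R)
    (V : X -> X -> R) (eta : R) :
  is_dist P -> is_stochastic V -> (forall x, out_dist P V x = P x) ->
  \sum_x P x * (\sum_z backward P V x z *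
                  ln (backward P V x z / center_dist P eta z)) =
  mutual_info P V + eta.
Proof.
move=> P1 V1 PV.
rewrite (backward_mean
  (fun x z => ln (backward P V x z / center_dist P eta z))) //.
have {2}-> : eta = \sum_a P a * (\sum_x V a x * eta).
  rewrite -[LHS]mul1r -P1.2 mulr_suml; apply: eq_bigr => a _.
  by rewrite -mulr_suml (V1 a).2 mul1r.
rewrite /mutual_info -big_split; apply: eq_bigr => a _ /=.
rewrite !mulr_sumr -big_split; apply: eq_bigr => x _ /=.
rewrite !mulrA -mulrDr PV.
have [->|PVax] := eqVneq (P a * V a x) 0; first by rewrite !mul0r.
have Px : 0 < P x.
  rewrite lt_def P1.1 andbT; apply: contra PVax => /eqP Px.
  by rewrite (joint_eq0 a P1 V1 PV Px).
have /andP[Pa Vax] : (0 < P a) && (0 < V a x).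
  by move: PVax; rewrite mulf_eq0 negb_or !lt_def P1.1 (V1 a).1 !andbT.
congr (_ * _); rewrite Px.
have -> : P a * V a x / P x / (expR (- eta) * P a) = V a x / P x * expR eta.
  by rewrite expRN; field; rewrite !gt_eqF ?expR_gt0.
by rewrite lnM ?posrE ?divr_gt0 ?expR_gt0 // expRK.
Qed.

Lemma limn_esup_le_near (R : realType) (f : nat -> \bar R) (l : \bar R) :
  (\forall k \near \oo, (f k <= l)%E) -> (limn_esup f <= l)%E.
Proof.
move=> fl; rewrite /limn_esup limf_esupE.
apply: (@le_trans _ _ (ereal_sup [set f x | x in [set k | (f k <= l)%E]])).
  by apply: ereal_inf_lbound; exists [set k | (f k <= l)%E].
by apply: ge_ereal_sup => _ [k kl <-].
Qed.

Lemma eventually_code_dist_le_vartheta (R : realType) (X Y : finType)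
    (W : X -> Y -> R) (rho : R) (P : X -> R) (V : X -> X -> R) (t : X -> R)
    (r eps : R) (n : nat -> nat) (C : forall k, {set {ffun 'I_(n k) -> X}})
    (Q : nat -> X -> R) :
  0 < rho -> is_dist P -> is_stochastic V ->
  (forall x, out_dist P V x = P x) ->
  (forall a, 0 < P a -> vartheta W rho (V a) = (t a)%:E) ->
  mutual_info P V + \sum_a P a * t a < r -> 0 < eps ->
  code_sequence r P C Q ->
  \forall k \near \oo,
    (code_dist W (C k) <= (rho * (\sum_a P a * t a + eps))%:E)%E.
Proof.
move=> rho0 P1 V1 PV Vt rt eps0 CQ; set T := \sum_a _ in rt *.
(* The two means will lie below [mutual_info P V + 2 * eta] and [T + 2 * eta], so [4 * eta] must
   stay below the rate gap and [2 * eta] below [eps]. *)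
have [eta [eta0 eta_eps eta_r]] : exists eta, [/\ 0 < eta, 3 * eta <= eps &
    5 * eta <= r - (mutual_info P V + T)].
  exists (Num.min eps (r - (mutual_info P V + T)) / 5).
  have : 0 < Num.min eps (r - (mutual_info P V + T)) by rewrite lt_min eps0 subr_gt0.
  have : Num.min eps (r - (mutual_info P V + T)) <= eps by rewrite ge_min lexx.
  have : Num.min eps (r - (mutual_info P V + T)) <= r - (mutual_info P V + T).
    by rewrite ge_min lexx orbT.
  by split; lra.
have reps_pos a : 0 < P a -> exists ug : (X -> option X -> R) * (option X -> R),
    [/\ forall x, dotr (ug.1 x) (ug.1 x) = 1, dotr ug.2 ug.2 = 1,
        forall x x', `|dotr (ug.1 x) (ug.1 x')| <=
                     dotr (psi W x) (psi W x') `^ rho^-1,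
        forall x, 0 < V a x -> 0 < dotr (ug.1 x) ug.2
      & \sum_x V a x * (- 2 * ln (dotr (ug.1 x) ug.2)) < t a + eta].
  move=> Pa; have : (vartheta W rho (V a) < (t a + eta)%:E)%E.
    by rewrite Vt // lte_fin ltrDl.
  by case/(vartheta_representation (V1 a)) => u [g ug]; exists (u, g).
have [a0 Pa0] : exists a0, 0 < P a0.
  have [//|/forallNP P_le0] := pselect (exists a0, 0 < P a0).
  have : \sum_a P a = 0.
    apply: big1 => a _; apply/eqP; rewrite eq_le P1.1 andbT leNgt.
    exact/negP.
  by rewrite P1.2 => /eqP; rewrite oner_eq0.
(* [u0] is an arbitrary admissible representation, used for the letters [inr b] and for the [inl a]
   with [P a = 0]. *)
have [[u0 g0] [/= u0u0 _ u0W _ _]] := reps_pos _ Pa0.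
have /choice[ug ugP] a : exists ug : (X -> option X -> R) * (option X -> R),
    [/\ forall x, dotr (ug.1 x) (ug.1 x) = 1, dotr ug.2 ug.2 = 1,
        forall x x', `|dotr (ug.1 x) (ug.1 x')| <=
                     dotr (psi W x) (psi W x') `^ rho^-1
      & 0 < P a -> (forall x, 0 < V a x -> 0 < dotr (ug.1 x) ug.2) /\
          \sum_x V a x * (- 2 * ln (dotr (ug.1 x) ug.2)) < t a + eta].
  have [Pa|Pa] := boolP (0 < P a).
    by have [ug [? ? ? ? ?]] := reps_pos a Pa; exists ug.
  by exists (u0, u0 a); split=> //= Pa'; rewrite Pa' in Pa.
pose u (z : X + X) := if z is inl a then (ug a).1 else u0.
pose g (z : X + X) := match z with inl a => (ug a).2 | inr b => u0 b end.
have Upos x z : 0 < backward P V x z ->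
    0 < center_dist P eta z /\ 0 < dotr (u z x) (g z).
  case: z => [a|b] /=; case: ifP => Px; rewrite ?ltxx //.
    rewrite pmulr_lgt0 ?invr_gt0 // => PVax.
    have [Pa Vax] : 0 < P a /\ 0 < V a x.
      by apply/andP; move: PVax; rewrite !lt_def mulf_eq0 negb_or P1.1
        (V1 a).1 !andbT => /andP[].
    split; first by rewrite mulr_gt0 ?expR_gt0.
    by case: (ugP a) => _ _ _ /(_ Pa)[/(_ x Vax)].
  rewrite ltr0n lt0b => /eqP bx; rewrite bx u0u0 ltr01; split=> //.
  rewrite divr_gt0 ?ltr0n //; last by apply/card_gt0P; exists x.
  by rewrite subr_gt0 -expR0 ltr_expR oppr_lt0.
have mean_c : \sum_x P x * (\sum_z backward P V x z *
    (- 2 * ln (dotr (u z x) (g z)))) < T + 2 * eta.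
  rewrite (backward_mean (fun x z => - 2 * ln (dotr (u z x) (g z)))) //=.
  apply: (@le_lt_trans _ _ (\sum_a P a * (t a + eta))).
    apply: ler_sum => a _.
    have [Pa|/negbTE Pa] := boolP (0 < P a).
      by rewrite ler_wpM2l ?P1.1 //; case: (ugP a) => _ _ _ /(_ Pa)[_ /ltW].
    have -> : P a = 0 by apply/eqP; rewrite eq_le P1.1 andbT leNgt Pa.
    by rewrite !mul0r.
  under eq_bigr do rewrite mulrDr.
  by rewrite big_split /= -mulr_suml P1.2 mul1r -/T; lra.
have mean_L : \sum_x P x * (\sum_z backward P V x z *
    ln (backward P V x z / center_dist P eta z)) < mutual_info P V + 2 * eta.
  by rewrite backward_log_mean //; lra.
have := @eventually_code_dist_le R X Y (X + X)%type (option X) W rho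
  (backward P V) (center_dist P eta) u g P _ _ (T + eps) r n C Q rho0
  (backward_is_stochastic P1 V1 PV) (center_dist_is_dist P1 eta0) Upos _ _ _
  mean_L mean_c _ _ CQ.
apply.
- by case=> [a|b] x //=; case: (ugP a).
- by case=> [a|b] //=; case: (ugP a).
- by case=> [a|b] //=; case: (ugP a).
- by lra.
- by lra.
Qed.

(** * Reduction to finite values and conclusion *)

Lemma vartheta_cond_fin (R : realType) (X Y : finType) (W : X -> Y -> R)
    (rho : R) (P : X -> R) (V : X -> X -> R) :
  is_dist P -> is_stochastic V -> (vartheta_cond W rho P V < +oo)%E ->
  exists t : X -> R,
    (forall a, 0 < P a -> vartheta W rho (V a) = (t a)%:E) /\
    vartheta_cond W rho P V = (\sum_a P a * t a)%:E.
Proof.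
move=> [P0 _] V1 cond_fin; exists (fun a => fine (vartheta W rho (V a))).
have theta0 a : (0 <= vartheta W rho (V a))%E by exact: vartheta_ge0.
have term0 a : (0 <= (P a)%:E * vartheta W rho (V a))%E.
  by rewrite mule_ge0 ?lee_fin.
(* An infinite value at a letter of positive probability would make the whole sum infinite, as the
   other terms are nonnegative. *)
have fin a : 0 < P a -> vartheta W rho (V a) = (fine (vartheta W rho (V a)))%:E.
  move=> Pa; rewrite fineK // ge0_fin_numE // ltey; apply/eqP => oo.
  move: cond_fin; rewrite /vartheta_cond (bigD1 a) //= oo gt0_muley ?lte_fin //.
  rewrite addye ?ltxx // gt_eqF //; apply: (@lt_le_trans _ _ 0%E) => //.
  exact: sume_ge0.
split=> //; rewrite /vartheta_cond -sumEFin; apply: eq_bigr => a _.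
have [Pa|/negbTE Pa] := boolP (0 < P a); first by rewrite [in LHS]fin // EFinM.
have -> : P a = 0 by apply/eqP; rewrite eq_le P0 andbT leNgt Pa.
by rewrite mul0r mul0e.
Qed.

Unset Implicit Arguments.

Theorem theorem3 (R : realType) (X Y : finType) (W : X -> Y -> R)
    (r : R) (P : X -> R) (rho : R) (V : X -> X -> R)
    (hW : is_stochastic W) (hP : is_dist P) (hrho : 1 <= rho)
    (hV : is_stochastic V)
    (hPV : forall x', out_dist P V x' = P x')
    (hr : ((mutual_info P V)%:E + vartheta_cond W rho P V < r%:E)%E) :
  (asymp_min_dist W r P <= rho%:E * vartheta_cond W rho P V)%E.
Proof.
have rho0 : 0 < rho by exact: lt_le_trans hrho.
have cond_fin : (vartheta_cond W rho P V < +oo)%E.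
  by rewrite ltey; apply/eqP => oo; rewrite oo addey in hr.
have [t [Vt condE]] := vartheta_cond_fin hP hV cond_fin.
rewrite condE -EFinD lte_fin in hr; rewrite condE -EFinM.
apply: ge_ereal_sup => _ [n [C [Q [CQ ->]]]].
apply/lee_addgt0Pr => e e0; apply: limn_esup_le_near.
(* A slack of [e / rho] in the exponent becomes [e] after multiplication by [rho]. *)
have e'0 : 0 < e / rho by rewrite divr_gt0.
have := eventually_code_dist_le_vartheta rho0 hP hV hPV Vt hr e'0 CQ.
by rewrite mulrDr [rho * (e / rho)]mulrC divfK ?gt_eqF // -EFinD.
Qed.
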